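(* Let $W:\mathrm{GL}^+(3)\to\mathbb{R}$ be a continuously differentiable isotropic elastic energy, written as $W(\lambda_1,\lambda_2,\lambda_3)$ in terms of the singular values of $F$, such that for all $\lambda>0$ $$\lambda\,\frac{\partial W}{\partial\lambda_1}\Big(\lambda,\tfrac1\lambda,1\Big)+\frac1\lambda\,\frac{\partial W}{\partial\lambda_2}\Big(\lambda,\tfrac1\lambda,1\Big)=0\qquad\text{and}\qquad\frac{\partial W}{\partial\lambda_3}\Big(\lambda,\tfrac1\lambda,1\Big)=0 .$$ Assume furthermore that $W$ is $p$-coercive for some $p\ge1$, i.e. $W(F)\ge d+c\,\|F\|^p$ for all $F\in\mathrm{GL}^+(3)$ with some $d\in\mathbb{R}$ and $c>0$, and that $W$ satisfies Hill's strict inequality $$\langle\tau(V_1)-\tau(V_2),\,\log V_1-\log V_2\rangle>0\qquad\text{for all }V_1,V_2\in\mathrm{Sym}^+(3),\ V_1\ne V_2 .$$ Then for $V\in\mathrm{Sym}^+(3)$, the Cauchy stress $\sigma(V)$ is a pure shear stress tensor (i.e. $\sigma(V)=s\,(e_1\otimes e_2+e_2\otimes e_1)$ for some $s\in\mathbb{R}$) if and only if $V$ is a finite pure shear stretch, i.e. $$V=\begin{pmatrix}\cosh\alpha&\sinh\alpha&0\\\sinh\alpha&\cosh\alpha&0\\0&0&1\end{pmatrix}\quad\text{for some }\alpha\in\mathbb{R}.$$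
   Context: $\mathrm{GL}^+(3)$ denotes the real $3\times3$ matrices with positive determinant and $\mathrm{Sym}^+(3)$ the positive definite symmetric $3\times3$ matrices; $\|\cdot\|$ is the Frobenius norm, $\langle X,Y\rangle=\mathrm{tr}(X^TY)$, and $\log$ is the principal matrix logarithm on $\mathrm{Sym}^+(3)$. A function $W:\mathrm{GL}^+(3)\to\mathbb{R}$ is (objective and) isotropic if $W(Q_1FQ_2)=W(F)$ for all $F\in\mathrm{GL}^+(3)$ and $Q_1,Q_2\in\mathrm{SO}(3)$; then $W(F)=W(\lambda_1,\lambda_2,\lambda_3)$ is a permutation-invariant function of the singular values of $F$. For $V\in\mathrm{Sym}^+(3)$ the Cauchy stress is $\sigma(V)=\frac{1}{\det V}DW(V)\,V$; it is diagonal in the same orthonormal eigenbasis as $V$, with eigenvalues $\sigma_i=\frac{\lambda_i}{\lambda_1\lambda_2\lambda_3}\frac{\partial W}{\partial\lambda_i}(\lambda_1,\lambda_2,\lambda_3)$, where $\lambda_i$ are the eigenvalues of $V$. The Kirchhoff stress is $\tau(V)=\det(V)\,\sigma(V)$. *)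

(* Defs.v *)
From HB Require Import structures.
From mathcomp Require Import all_boot all_order all_algebra.
From mathcomp Require Import all_classical all_reals all_analysis.
Set Implicit Arguments.
Unset Strict Implicit.
Unset Printing Implicit Defensive.
Import Order.TTheory GRing.Theory Num.Theory.
Import numFieldNormedType.Exports.
Local Open Scope classical_set_scope.
Local Open Scope ring_scope.

(* An energy on GL^+(3) is represented by a total function W : 'M[R]_3 -> R;
   every hypothesis below constrains W on the open set GL^+(3) only. *)

Definition GLp {R : realType} : set 'M[R]_3 := [set F | 0 < \det F].

Definition SO3 {R : realType} : set 'M[R]_3 :=
  [set Q | Q^T *m Q = 1%:M /\ \det Q = 1].

Definition Symp {R : realType} : set 'M[R]_3 :=
  [set V | V^T = V /\ forall x : 'cV[R]_3, x != 0 -> 0 < (x^T *m V *m x) 0 0].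

Definition frob_inner {R : realType} (X Y : 'M[R]_3) : R := \tr (X^T *m Y).

Definition frob_norm {R : realType} (X : 'M[R]_3) : R :=
  Num.sqrt (frob_inner X X).

(* DW(F), identified with a matrix through the Frobenius inner product. *)
Definition grad {R : realType} (W : 'M[R]_3 -> R) (F : 'M[R]_3) : 'M[R]_3 :=
  \matrix_(i, j) 'D_(delta_mx i j) W F.

Definition C1_energy {R : realType} (W : 'M[R]_3 -> R) : Prop :=
  forall F, GLp F -> differentiable W F /\ {for F, continuous (grad W)}.

Definition isotropic {R : realType} (W : 'M[R]_3 -> R) : Prop :=
  forall F Q1 Q2, GLp F -> SO3 Q1 -> SO3 Q2 -> W (Q1 *m F *m Q2) = W F.

Definition vec3 {R : realType} (a b c : R) : 'rV[R]_3 :=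
  \row_i nth 0 [:: a; b; c] i.

(* For isotropic W and F = Q1 diag(l) Q2 with Q1, Q2 in SO(3), W F is the value
   of W at diag(l); this is W as a function of the singular values. *)
Definition sv_energy {R : realType} (W : 'M[R]_3 -> R) (l : 'rV[R]_3) : R :=
  W (diag_mx l).

Definition sv_partial {R : realType} (W : 'M[R]_3 -> R) (i : 'I_3)
  (l : 'rV[R]_3) : R := 'D_(delta_mx 0 i) (sv_energy W) l.

Definition cauchy_stress {R : realType} (W : 'M[R]_3 -> R) (V : 'M[R]_3) :
  'M[R]_3 := (\det V)^-1 *: (grad W V *m V).

Definition kirchhoff_stress {R : realType} (W : 'M[R]_3 -> R) (V : 'M[R]_3) :
  'M[R]_3 := \det V *: cauchy_stress W V.

(* L = log V through an orthonormal eigenbasis of V in Sym^+(3). *)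
Definition is_symlog {R : realType} (V L : 'M[R]_3) : Prop :=
  exists (Q : 'M[R]_3) (d : 'rV[R]_3),
    [/\ Q^T *m Q = 1%:M, forall i, 0 < d 0 i,
        V = Q *m diag_mx d *m Q^T
      & L = Q *m diag_mx (map_mx (@ln R) d) *m Q^T].

(* The default value 0 is only taken outside Sym^+(3), where no
   decomposition as in is_symlog exists. *)
Definition symlog {R : realType} (V : 'M[R]_3) : 'M[R]_3 :=
  xget 0 [set L | is_symlog V L].

Lemma is_symlog_unique {R : realType} (V L1 L2 : 'M[R]_3) :
  is_symlog V L1 -> is_symlog V L2 -> L1 = L2.
Proof.
move=> [Q1 [d1 [q1 p1 V1 ->]]] [Q2 [d2 [q2 p2 V2 ->]]].
have r1 : Q1 *m Q1^T = 1%:M by exact: mulmx1C.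
have r2 : Q2 *m Q2^T = 1%:M by exact: mulmx1C.
pose M := Q2^T *m Q1.
have MD : M *m diag_mx d1 = diag_mx d2 *m M.
  have : Q2^T *m V *m Q1 = Q2^T *m V *m Q1 by [].
  by rewrite {1}V1 V2 /M !mulmxA q2 mul1mx -!mulmxA q1 mulmx1.
have ML : M *m diag_mx (map_mx (@ln R) d1) = diag_mx (map_mx (@ln R) d2) *m M.
  apply/matrixP => i j.
  have /matrixP/(_ i j) := MD.
  rewrite !mul_mx_diag !mul_diag_mx mxE [in RHS]mxE => Eij.
  rewrite mxE [RHS]mxE ![map_mx _ _ _ _]mxE.
  have [-> | M0] := eqVneq (M i j) 0; first by rewrite mul0r mulr0.
  suff -> : d1 0 j = d2 0 i by rewrite mulrC.
  by apply: (mulIf M0); rewrite -Eij mulrC.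
have E : Q2 *m M = Q1 by rewrite mulmxA r2 mul1mx.
have MQ : M *m Q1^T = Q2^T by rewrite /M -mulmxA r1 mulmx1.
rewrite -[X in X *m _ *m _ = _]E -(mulmxA Q2) ML mulmxA -[LHS]mulmxA.
by rewrite MQ.
Qed.

Lemma symlogP {R : realType} (V L : 'M[R]_3) : is_symlog V L -> symlog V = L.
Proof.
by move=> VL; apply: xget_unique => // L' VL'; exact: is_symlog_unique VL' VL.
Qed.

Definition hill_strict {R : realType} (W : 'M[R]_3 -> R) : Prop :=
  forall V1 V2, Symp V1 -> Symp V2 -> V1 <> V2 ->
    0 < frob_inner (kirchhoff_stress W V1 - kirchhoff_stress W V2)
                   (symlog V1 - symlog V2).

Definition coercive {R : realType} (W : 'M[R]_3 -> R) (p : R) : Prop :=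
  exists d c : R, 0 < c /\ forall F, GLp F -> d + c * frob_norm F `^ p <= W F.

Definition cosh {R : realType} (x : R) : R := (expR x + expR (- x)) / 2.
Definition sinh {R : realType} (x : R) : R := (expR x - expR (- x)) / 2.

(* delta_mx 0 1 is e_1 (x) e_2: ordinals start at 0. *)
Definition pure_shear_stress {R : realType} (S : 'M[R]_3) : Prop :=
  exists s : R, S = s *: (delta_mx 0 1 + delta_mx 1 0).

Definition pure_shear_stretch {R : realType} (V : 'M[R]_3) : Prop :=
  exists a : R, V = \matrix_(i, j)
    nth 0 (nth [::] [:: [:: cosh a; sinh a; 0];
                        [:: sinh a; cosh a; 0];
                        [::      0;      0; 1]] i) j.

(* Main.v *)
Require Import Defs.
From mathcomp Require Import all_boot all_order all_algebra ring lra.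
From mathcomp Require Import all_classical all_reals all_analysis.
Set Implicit Arguments.
Unset Strict Implicit.
Unset Printing Implicit Defensive.
Import Order.TTheory GRing.Theory Num.Theory.
Import numFieldNormedType.Exports.
Local Open Scope classical_set_scope.
Local Open Scope ring_scope.

(** Hill's inequality makes V |-> tau(V) injective, so it suffices to find, for
    every real s, a pure shear stretch V_a whose Kirchhoff stress is
    s (e1 (x) e2 + e2 (x) e1).  The stretch V_a = Q diag(e^a, e^-a, 1) Q^T is
    diagonalised by the rotation Q by 45 degrees about e3, and by isotropy and
    the two hypotheses on W its Kirchhoff stress is Q diag(t, -t, 0) Q^T, i.e.
    t (e1 (x) e2 + e2 (x) e1), where 2t is the derivative at a of
    f(a) = W(diag(e^a, e^-a, 1)).  By coercivity f(a) - 2sa tends to +oo at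
    both ends, hence has a minimum, and there t = s. *)

Lemma is_derive_scalel {R : realType} {V : normedModType R} (f : R -> R)
    (v : V) (a df : R) :
  is_derive a 1 f df -> is_derive a 1 (fun t => f t *: v) (df *: v).
Proof.
move=> fa; have fd : differentiable f a by apply/derivable1_diffP.
have fv : differentiable (fun t => f t *: v) a by exact: differentiableZl.
split; first exact: diff_derivable.
by rewrite deriveE // (diffZl _ fd) -deriveE // (@derive_val _ _ _ _ _ _ _ fa).
Qed.

(** * Gradients of isotropic energies *)

Section FrechetGradient.
Context {R : realType}.
Implicit Types (W : 'M[R]_3 -> R) (F H Q : 'M[R]_3).

Lemma diff_grad W F H : differentiable W F ->
  'd W F H = \sum_i \sum_j H i j * grad W F i j.
Proof.
move=> dW; rewrite {1}(matrix_sum_delta H) linear_sum; apply: eq_bigr => i _.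
rewrite linear_sum; apply: eq_bigr => j _.
by rewrite linearZ /= mxE deriveE.
Qed.

Lemma continuous_det n : continuous (fun F : 'M[R]_n.+1 => \det F).
Proof.
rewrite /determinant.
apply: continuous_big => [|s _]; first exact: add_continuous.
move=> F; apply: (@cvgM R _ (nbhs F)); first exact: cvg_cst.
apply: cvg_big => [|i _]; first exact: mul_continuous.
exact: coord_continuous.
Qed.

Lemma nbhs_GLp F : GLp F -> nbhs F (@GLp R).
Proof.
move=> F0; have := @continuous_det 2 F.
move=> /(_ [set x | 0 < x]); apply.
exact: lt_nbhsr.
Qed.

(** Differentiating [W X = W (Q^T *m X *m Q)] at [Q *m F *m Q^T] along a basis matrix gives the
    derivative of [W] at [F] along the conjugated basis matrix, which [diff_grad] expands. *)
Lemma grad_conj W F Q : C1_energy W -> isotropic W -> GLp F -> SO3 Q ->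
  grad W (Q *m F *m Q^T) = Q *m grad W F *m Q^T.
Proof.
move=> W_C1 W_iso F0 [QtQ Q1].
have QQt : Q *m Q^T = 1%:M by exact: mulmx1C.
set V := Q *m F *m Q^T.
have V0 : GLp V by rewrite /GLp /= /V !det_mulmx det_tr Q1 mul1r mulr1.
have E : Q^T *m V *m Q = F by rewrite /V !mulmxA QtQ mul1mx -mulmxA QtQ mulmx1.
have SQ : SO3 Q by [].
have SQt : SO3 Q^T by split; rewrite ?trmxK ?det_tr.
apply/matrixP => i j; rewrite mxE.
(* Isotropy holds only on GL^+(3); that set is open, so the two functions agree near [V], which
   suffices for the derivative. *)
rewrite (@near_eq_derive _ _ _ W (fun X => W (Q^T *m X *m Q))); last first.
  near=> X; rewrite W_iso //; near: X; exact: nbhs_GLp.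
have -> : 'D_(delta_mx i j) (fun X => W (Q^T *m X *m Q)) V =
          'D_(Q^T *m delta_mx i j *m Q) W F.
  rewrite /derive -E; apply: (congr1 (fun f : R -> R => lim (f @ 0^'))).
  apply/funext => h /=.
  by rewrite mulmxDr mulmxDl -scalemxAr -scalemxAl.
have [dW _] := W_C1 _ F0.
rewrite deriveE // diff_grad // mxE exchange_big; apply: eq_bigr => l _.
rewrite [in RHS]mxE mulr_suml; apply: eq_bigr => k _.
have -> : (Q^T *m delta_mx i j *m Q) k l = Q i k * Q j l.
  rewrite mxE (bigD1 j) //= big1 => [|j' /negPf j'j]; last first.
    rewrite mxE big1 ?mul0r// => i' _.
    by rewrite [delta_mx _ _ _ _]mxE j'j andbF mulr0.
  rewrite addr0 mxE (bigD1 i) //= big1 => [|i' /negPf i'i]; last first.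
    by rewrite [delta_mx _ _ _ _]mxE i'i mulr0.
  by rewrite addr0 !mxE !eqxx mulr1.
by rewrite [Q^T _ _]mxE; ring.
Unshelve. all: by end_near.
Qed.

(* Conjugation by the rotation diag(+-1) with entry 1 at i and -1 elsewhere
   fixes diagonal matrices and flips the (i, j) entries of the gradient. *)
Lemma grad_diag_mx W (l : 'rV[R]_3) :
  C1_energy W -> isotropic W -> GLp (diag_mx l) ->
  grad W (diag_mx l) = diag_mx (\row_i sv_partial W i l).
Proof.
move=> W_C1 W_iso l0; apply/matrixP => i j; rewrite [RHS]mxE.
have [<- | ij] := eqVneq i j; last first.
  pose d : 'rV[R]_3 := \row_k (if k == i then 1 else -1).
  have dd k : d 0 k * d 0 k = 1 by rewrite mxE; case: ifP => _; ring.
  have SO : SO3 (diag_mx d).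
    split.
      rewrite tr_diag_mx mulmx_diag -diag_const_mx; congr diag_mx.
      by apply/rowP => k; rewrite [LHS]mxE dd mxE.
    rewrite det_diag (bigD1 i) //= mxE eqxx mul1r.
    rewrite (eq_bigr (fun=> -1)) => [|k /negPf ki]; last by rewrite mxE ki.
    by rewrite prodr_const cardC1 card_ord sqrrN expr1n.
  have := grad_conj W_C1 W_iso l0 SO; rewrite tr_diag_mx.
  have -> : diag_mx d *m diag_mx l *m diag_mx d = diag_mx l.
    rewrite !mulmx_diag; congr diag_mx; apply/rowP => k.
    by rewrite [LHS]mxE [X in X * _]mxE mulrAC dd mul1r.
  set G := grad W _; clearbody G => /matrixP/(_ i j).
  rewrite mul_mx_diag mul_diag_mx !mxE eqxx eq_sym (negPf ij) mulr0n.
  lra.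
(* On the diagonal, a perturbation along [delta_mx i i] stays among diagonal matrices, so both
   difference quotients coincide. *)
rewrite mulr1n [LHS]mxE [RHS]mxE /sv_partial /derive.
apply: (congr1 (fun f : R -> R => lim (f @ 0^'))); apply/funext => h /=.
have -> : sv_energy W (h *: delta_mx 0 i + l) =
    W (h *: diag_mx (delta_mx 0 i) + diag_mx l).
  by rewrite /sv_energy linearD linearZ.
have -> // : delta_mx i i = diag_mx (delta_mx 0 i) :> 'M[R]_3.
apply/matrixP => k k'; rewrite !mxE eqxx /=.
have [->|] := eqVneq k k'; first by rewrite andbb.
by have [-> | //] := eqVneq k i; rewrite eq_sym => /negPf ->.
Qed.

End FrechetGradient.

(** * Pure shear stretches and stresses in a common eigenbasis *)

Section PureShear.
Context {R : realType}.
Implicit Types (W : 'M[R]_3 -> R) (a b c s : R).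

Definition shear_mx s : 'M[R]_3 := s *: (delta_mx 0 1 + delta_mx 1 0).

Definition pure_stretch a : 'M[R]_3 := \matrix_(i, j)
  nth 0 (nth [::] [:: [:: cosh a; sinh a; 0];
                      [:: sinh a; cosh a; 0];
                      [::      0;      0; 1]] i) j.

Definition principal_stretch a : 'M[R]_3 :=
  diag_mx (vec3 (expR a) (expR (- a)) 1).

(** The columns are orthonormal eigenvectors shared by all pure shear stretches and all pure shear
    stresses. *)
Definition rot45 : 'M[R]_3 := let r := Num.sqrt (2^-1) in \matrix_(i, j)
  nth 0 (nth [::] [:: [:: r; - r; 0];
                      [:: r;   r; 0];
                      [:: 0;   0; 1]] i) j.

(** One formula with three uses: eigenvalues [expR a], [expR (- a)], 1 give the stretch, [s], [- s],
    0 the stress, and 1, 1, 1 the orthogonality of [rot45]. *)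
Lemma rot45_conj a b c :
  rot45 *m diag_mx (vec3 a b c) *m rot45^T = \matrix_(i, j)
  nth 0 (nth [::] [:: [:: (a + b) / 2; (a - b) / 2; 0];
                      [:: (a - b) / 2; (a + b) / 2; 0];
                      [::           0;           0; c]] i) j.
Proof.
have r2 : Num.sqrt (2^-1) * Num.sqrt (2^-1) = 2^-1 :> R.
  by rewrite -expr2 sqr_sqrtr // invr_ge0.
apply/matrixP => i j; rewrite mul_mx_diag mxE !big_ord_recl big_ord0 !mxE /=.
move: (Num.sqrt _) r2 => r r2.
by case: i => [[|[|[|//]]] ?]; case: j => [[|[|[|//]]] ?] /=; ring: r2.
Qed.

Lemma SO3_rot45 : SO3 rot45.
Proof.
have r1 : rot45 *m rot45^T = 1%:M.
  have := rot45_conj 1 1 1.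
  have -> : vec3 1 1 1 = const_mx 1 :> 'rV[R]_3.
    by apply/rowP => -[[|[|[|//]]] ?]; rewrite !mxE.
  rewrite diag_const_mx mulmx1 => ->; apply/matrixP => i j; rewrite !mxE.
  by case: i => [[|[|[|//]]] ?]; case: j => [[|[|[|//]]] ?] //=; field.
split; first exact: mulmx1C.
have r2 : Num.sqrt (2^-1) * Num.sqrt (2^-1) = 2^-1 :> R.
  by rewrite -expr2 sqr_sqrtr // invr_ge0.
rewrite (expand_det_row _ ord_max) !big_ord_recl big_ord0 !mxE /=.
rewrite !mul0r !add0r mul1r addr0 /cofactor.
rewrite (expand_det_row _ ord0) !big_ord_recl big_ord0 /cofactor !det_mx11.
rewrite !mxE /=.
rewrite (_ : bump 0 0 = 1%N) // (_ : bump 0 1 = 2%N) //.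
by move: (Num.sqrt _) r2 => r r2; rewrite [RHS](splitr 1) mul1r -r2; ring.
Qed.

Lemma pure_stretch_rot45 a :
  pure_stretch a = rot45 *m principal_stretch a *m rot45^T.
Proof. by rewrite rot45_conj. Qed.

Lemma shear_mx_rot45 s :
  shear_mx s = rot45 *m diag_mx (vec3 s (- s) 0) *m rot45^T.
Proof.
rewrite rot45_conj; apply/matrixP => i j; rewrite !mxE.
by case: i => [[|[|[|//]]] ?]; case: j => [[|[|[|//]]] ?] //=; field.
Qed.

Lemma det_principal_stretch a : \det (principal_stretch a) = 1.
Proof.
rewrite det_diag !big_ord_recl big_ord0 !mxE /=.
by rewrite !mulr1 -expRD subrr expR0.
Qed.

Lemma GLp_principal_stretch a : GLp (principal_stretch a).
Proof. by rewrite /GLp /= det_principal_stretch. Qed.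

Lemma det_pure_stretch a : \det (pure_stretch a) = 1.
Proof.
have [_ r1] := SO3_rot45.
by rewrite pure_stretch_rot45 !det_mulmx det_tr r1 det_principal_stretch !mulr1.
Qed.

Lemma Symp_pure_stretch a : Symp (pure_stretch a).
Proof.
split.
  apply/matrixP => i j; rewrite !mxE.
  by case: i => [[|[|[|//]]] ?]; case: j => [[|[|[|//]]] ?].
move=> x x0.
(* Eigenvector coordinates turn the form into a sum of squares with positive weights, which vanishes
   only at [x = 0]. *)
have -> : (x^T *m pure_stretch a *m x) 0 0 =
  expR a * (x 0 0 + x 1 0) ^+ 2 / 2 + expR (- a) * (x 0 0 - x 1 0) ^+ 2 / 2
  + x 2 0 ^+ 2.
  rewrite mxE !big_ord_recl big_ord0 !mxE !big_ord_recl !big_ord0 !mxE /=.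
  rewrite /cosh /sinh.
  have -> : lift ord0 ord0 = 1 :> 'I_3 by exact/val_inj.
  have -> : lift ord0 (lift ord0 ord0) = 2 :> 'I_3 by exact/val_inj.
  by field.
have ea := expR_gt0 a; have eNa := expR_gt0 (- a).
have := sqr_ge0 (x 0 0 + x 1 0); have := sqr_ge0 (x 0 0 - x 1 0).
have := sqr_ge0 (x 2 0).
rewrite lt_neqAle => h1 h2 h3; apply/andP; split; last by nra.
apply: contra x0 => /eqP E; apply/eqP.
have e1 : (x 0 0 + x 1 0) ^+ 2 = 0 by nra.
have e2 : (x 0 0 - x 1 0) ^+ 2 = 0 by nra.
have e3 : (x 2 0) ^+ 2 = 0 by nra.
move/eqP: e1; rewrite sqrf_eq0 => /eqP e1.
move/eqP: e2; rewrite sqrf_eq0 => /eqP e2.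
move/eqP: e3; rewrite sqrf_eq0 => /eqP e3.
apply/colP => i; rewrite [RHS]mxE.
case: i => [[|[|[|//]]] i3].
- by rewrite (_ : Ordinal i3 = 0) //; [lra|exact/val_inj].
- by rewrite (_ : Ordinal i3 = 1) //; [lra|exact/val_inj].
- by rewrite (_ : Ordinal i3 = 2) //; exact/val_inj.
Qed.

Lemma is_derive_principal_stretch a :
  is_derive a 1 principal_stretch
    (diag_mx (vec3 (expR a) (- expR (- a)) 0)).
Proof.
pose path0 (t : R) : 'M[R]_3 := expR t *: delta_mx 0 0.
pose path1 (t : R) : 'M[R]_3 := expR (- t) *: delta_mx 1 1.
have -> : principal_stretch = path0 + path1 + cst (delta_mx 2 2).
  apply/funext => t; apply/matrixP => i j; rewrite !mxE.
  by case: i => [[|[|[|//]]] ?]; case: j => [[|[|[|//]]] ?] //=;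
    rewrite ?mulr1n ?mulr0n; ring.
have dNe : is_derive a 1 (fun t : R => expR (- t)) (- expR (- a)).
  have : is_derive a 1 (@expR R \o -%R) (expR (- a) * -1).
    by apply: is_derive1_comp.
  by rewrite mulrN1.
have d0 : is_derive a 1 path0 (expR a *: delta_mx 0 0).
  exact: is_derive_scalel.
have d1 : is_derive a 1 path1 (- expR (- a) *: delta_mx 1 1).
  exact: is_derive_scalel.
have d2 : is_derive a (1 : R) (cst (delta_mx 2 2 : 'M[R]_3)) 0.
  exact: is_derive_cst.
have := is_deriveD (is_deriveD d0 d1) d2.
suff -> : diag_mx (vec3 (expR a) (- expR (- a)) 0) =
  expR a *: delta_mx 0 0 + - expR (- a) *: delta_mx 1 1 + 0 by [].
apply/matrixP => i j; rewrite !mxE.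
by case: i => [[|[|[|//]]] ?]; case: j => [[|[|[|//]]] ?] //=;
  rewrite ?mulr1n ?mulr0n; ring.
Qed.

(** * The energy along the path of pure shear stretches *)

Definition shear_energy W a : R := W (principal_stretch a).

(** By the chain rule, the diagonal tangent of the path is paired with the gradient; its zero third
    entry removes the third partial derivative. *)
Lemma is_derive_shear_energy W a : C1_energy W -> isotropic W ->
  is_derive a 1 (shear_energy W)
    (expR a * sv_partial W 0 (vec3 (expR a) (expR (- a)) 1)
     - expR (- a) * sv_partial W 1 (vec3 (expR a) (expR (- a)) 1)).
Proof.
move=> W_C1 W_iso.
have Ga := GLp_principal_stretch a; have [dW _] := W_C1 _ Ga.
have da := is_derive_principal_stretch a.
have dp : differentiable principal_stretch a by apply/derivable1_diffP.
have dWp : differentiable (W \o principal_stretch) a.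
  exact: differentiable_comp.
split; first exact: diff_derivable.
rewrite deriveE //.
have -> : 'd (W \o principal_stretch) a 1 =
    'd W (principal_stretch a) ('d principal_stretch a 1).
  by rewrite diff_comp.
rewrite -(deriveE _ dp) (@derive_val _ _ _ _ _ _ _ da) diff_grad //.
rewrite grad_diag_mx //.
have E x y (g : 'rV[R]_3) :
    \sum_i \sum_j diag_mx (vec3 x y 0) i j * diag_mx g i j
    = x * g 0 0 + y * g 0 1.
  rewrite !big_ord_recl !big_ord0 !mxE /=.
  have -> : lift ord0 ord0 = 1 :> 'I_3 by exact/val_inj.
  by rewrite !mulr1n !mulr0n; ring.
by rewrite E mulNr 2![in LHS]mxE.
Qed.

(** At [l = expR a] the first hypothesis makes the first two principal Kirchhoff stresses opposite,
    [s] and [- s], and the second kills the third. Their difference [2 * s] is the slope of the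
    energy. *)
Lemma kirchhoff_pure_stretch W a : C1_energy W -> isotropic W ->
  (forall l : R, 0 < l ->
     l * sv_partial W 0 (vec3 l l^-1 1)
     + l^-1 * sv_partial W 1 (vec3 l l^-1 1) = 0) ->
  (forall l : R, 0 < l -> sv_partial W 2 (vec3 l l^-1 1) = 0) ->
  let s := expR a * sv_partial W 0 (vec3 (expR a) (expR (- a)) 1) in
  is_derive a 1 (shear_energy W) (2 * s) /\
  grad W (pure_stretch a) *m pure_stretch a = shear_mx s.
Proof.
move=> W_C1 W_iso W_shear12 W_shear3 s.
have := W_shear12 _ (expR_gt0 a); have := W_shear3 _ (expR_gt0 a).
rewrite -expRN addrC => h3 /eqP; rewrite addr_eq0 => /eqP h1; split.
  have := is_derive_shear_energy a W_C1 W_iso.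
  have -> // : expR a * sv_partial W 0 (vec3 (expR a) (expR (- a)) 1)
     - expR (- a) * sv_partial W 1 (vec3 (expR a) (expR (- a)) 1) = 2 * s.
  by rewrite h1 opprK mulr_natl mulr2n.
have SO := SO3_rot45; have [r1 _] := SO; have Ga := GLp_principal_stretch a.
rewrite pure_stretch_rot45 grad_conj // shear_mx_rot45.
rewrite -!mulmxA (mulmxA rot45^T rot45) r1 mul1mx !mulmxA; congr (_ *m _).
rewrite grad_diag_mx // -mulmxA mulmx_diag; congr (_ *m diag_mx _).
apply/rowP => i; rewrite !mxE.
case: i => [[|[|[|//]]] i3] /=.
- have -> : Ordinal i3 = 0 by exact/val_inj.
  by rewrite mulrC.
- have -> : Ordinal i3 = 1 by exact/val_inj.
  by rewrite mulrC h1.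
- have -> : Ordinal i3 = 2 by exact/val_inj.
  by rewrite h3 mul0r.
Qed.

(** Quadratic growth is enough to beat any linear term. The norm is at least 1, so its [p]-th power
    dominates the norm itself, which is at least [expR |a|]. *)
Lemma coercive_shear_energy W p : 1 <= p -> coercive W p ->
  exists d c, 0 < c /\ forall a, d + c * a ^+ 2 <= shear_energy W a.
Proof.
move=> p1 [d [c [c0 Wc]]]; exists d, (c / 4); split; first by rewrite divr_gt0.
move=> a; apply: le_trans (Wc _ (GLp_principal_stretch a)).
rewrite lerD2l -mulrA ler_pM2l //.
have nE : frob_norm (principal_stretch a) =
    Num.sqrt (expR a ^+ 2 + expR (- a) ^+ 2 + 1).
  rewrite /frob_norm /frob_inner tr_diag_mx mulmx_diag; congr Num.sqrt.
  by rewrite mxtrace_diag !big_ord_recl big_ord0 !mxE /=; ring.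
have ea := expR_gt0 a; have eNa := expR_gt0 (- a).
have n1 : 1 <= frob_norm (principal_stretch a).
  by rewrite nE -[leLHS]sqrtr1 ler_sqrt; nra.
(* Squaring [1 + t / 2 <= expR (t / 2)] gives the bound. *)
have e_half : forall t : R, 0 <= t -> 4^-1 * t ^+ 2 <= expR t.
  move=> t t0; have -> : t = t / 2 + t / 2 by field.
  rewrite expRD; have := expR_ge1Dx (t / 2); nra.
have ne : expR `|a| <= frob_norm (principal_stretch a).
  rewrite nE -[leLHS]gtr0_norm ?expR_gt0 // -sqrtr_sqr ler_sqrt; last by nra.
  by case: (ger0P a) => _; nra.
apply: le_trans (_ : frob_norm (principal_stretch a) `^ 1 <= _); last first.
  exact: ler_powR.
rewrite powRr1; last by apply: le_trans n1.
apply: le_trans ne; apply: le_trans (e_half _ (normr_ge0 a)).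
by rewrite real_normK ?num_real.
Qed.

Lemma shear_energy_slope_onto W p s : C1_energy W -> isotropic W ->
  1 <= p -> coercive W p -> exists a, is_derive a 1 (shear_energy W) (2 * s).
Proof.
move=> W_C1 W_iso p1 Wp.
have [d [c [c0 Wc]]] := coercive_shear_energy p1 Wp.
pose g a := shear_energy W a - 2 * s * a.
have dW a : derivable (shear_energy W) a 1.
  by have [] := is_derive_shear_energy a W_C1 W_iso.
have dg a : is_derive a 1 g ('D_1 (shear_energy W) a - 2 * s).
  have dWa : is_derive a 1 (shear_energy W) ('D_1 (shear_energy W) a).
    by split.
  have -> : g = shear_energy W - (2 * s) *: id by apply/funext.
  have -> : 'D_1 (shear_energy W) a - 2 * s =
            'D_1 (shear_energy W) a - (2 * s) *: 1 by rewrite [_ *: 1]mulr1.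
  exact: is_deriveB.
(* [A] is chosen so that c A^2 >= (2|s| + K) A >= 2|s| A + K; hence at both endpoints [g] is at
   least [d + K], which exceeds [g 0]. *)
pose K := `|g 0 - d| + 1.
pose A := 1 + (2 * `|s| + K) / c.
have K0 : 0 < K by rewrite ltr_pwDr.
have A1 : 1 <= A.
  by rewrite lerDl divr_ge0 ?addr_ge0 ?mulr_ge0 // ltW.
have cA : 2 * `|s| + K <= c * A.
  by rewrite /A mulrDr mulr1 mulrCA divff ?gt_eqF // mulr1 lerDr ltW.
have gA a : `|a| = A -> g 0 < g a.
  move=> aA; have := Wc a; rewrite -(lerD2r (- (2 * s * a))).
  apply: lt_le_trans.
  have sa : s * a <= `|s| * A by rewrite -aA -normrM ler_norm.
  have g0 : g 0 - d < K by rewrite /K; have := ler_norm (g 0 - d); lra.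
  rewrite -real_normK ?num_real // aA.
  by nra.
have NA : - A <= A by lra.
have gc : {within `[- A, A], continuous g}.
  apply: continuous_subspaceT => a; apply: differentiable_continuous.
  by apply/derivable1_diffP; have [] := dg a.
have absA : `|A| = A by rewrite ger0_norm ?(le_trans _ A1).
have [a aA amin] := EVT_min NA gc.
(* A minimiser satisfies [g a <= g 0], so it cannot be an endpoint, and the derivative of [g]
   vanishes there. *)
have aI : a \in `]- A, A[.
  have g0 : g a <= g 0
    by apply: amin; rewrite in_itv /=; apply/andP; split; lra.
  move: aA; rewrite !in_itv /= => /andP[].
  rewrite !le_eqVlt => /orP[/eqP aE|-> /orP[/eqP aE|->//]].
    by have := gA a; rewrite ltNge g0 -aE normrN absA => /(_ erefl).
  by have := gA a; rewrite ltNge g0 aE absA => /(_ erefl).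
exists a.
have dg0 : is_derive a 1 g 0.
  apply: (derive1_at_min NA _ aI) => t tA; first by have [] := dg t.
  by apply: amin; exact: subset_itv_oo_cc.
split=> //; have := @derive_val _ _ _ _ _ _ _ (dg a).
rewrite (@derive_val _ _ _ _ _ _ _ dg0) => /esym/eqP.
by rewrite subr_eq0 => /eqP.
Qed.

End PureShear.

(** * Identification of the stretch through Hill's inequality *)

Theorem theorem4p8 (R : realType) (W : 'M[R]_3 -> R)
  (W_C1 : C1_energy W) (W_iso : isotropic W)
  (W_shear12 : forall l : R, 0 < l ->
     l * sv_partial W 0 (vec3 l l^-1 1)
     + l^-1 * sv_partial W 1 (vec3 l l^-1 1) = 0)
  (W_shear3 : forall l : R, 0 < l -> sv_partial W 2 (vec3 l l^-1 1) = 0)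
  (p : R) (p_ge1 : 1 <= p) (W_coercive : coercive W p)
  (W_hill : hill_strict W) (V : 'M[R]_3) (V_Symp : Symp V) :
  pure_shear_stress (cauchy_stress W V) <-> pure_shear_stretch V.
Proof.
have key a := kirchhoff_pure_stretch a W_C1 W_iso W_shear12 W_shear3.
split=> [[s sE]|[a VE]]; last first.
  have [_ E] := key a; rewrite -/(pure_stretch a) in VE.
  rewrite VE /cauchy_stress E det_pure_stretch invr1 scale1r.
  by eexists.
(* The factor [\det V] converts the Cauchy stress of [V] to its Kirchhoff stress, which the stretch
   found here must match. *)
have [a da] := shear_energy_slope_onto (\det V * s) W_C1 W_iso p_ge1 W_coercive.
have [da' Ea] := key a.
exists a; rewrite -/(pure_stretch a); apply: contrapT => Va.
have Ks : kirchhoff_stress W V = shear_mx (\det V * s).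
  by rewrite /kirchhoff_stress sE scalerA.
have Ka : kirchhoff_stress W (pure_stretch a) = shear_mx (\det V * s).
  (* The slope at [a] is known in two ways; equating them identifies the shear coefficient. *)
  rewrite /kirchhoff_stress /cauchy_stress Ea det_pure_stretch invr1 !scale1r.
  congr shear_mx; have := @derive_val _ _ _ _ _ _ _ da.
  rewrite (@derive_val _ _ _ _ _ _ _ da') => /mulfI; apply.
  by rewrite pnatr_eq0.
(* Equal Kirchhoff stresses make Hill's inner product zero, against strictness for distinct
   stretches. *)
have := W_hill _ _ V_Symp (Symp_pure_stretch a) Va.
by rewrite Ks Ka subrr /frob_inner trmx0 mul0mx mxtrace0 ltxx.
Qed.
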